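(* Let $(P,T)$ be a strong aut descendable autonomous system with autonomous sets $A$ and $B$ and points $x,y\in A\cap B$ such that $x<_A y$ and $y<_B x$. Then $(P,T)$ has an induced minor isomorphic to $P_4$.
   Context: An autonomous system is a set $P$ together with a set $T$ of subsets of $P$, called autonomous sets, such that (i) $T$ is closed under arbitrary union (including the empty union, so $\emptyset\in T$), and (ii) (order property) for every $A\in T$ there is a total order $\le'$ of $A$ such that every $\le'$ downward closed subset of $A$ is in $T$. Standing assumption on the given system: $P$ itself is autonomous, i.e. $P\in T$. For an autonomous set $A$ and $x,y\in A$, the canonical order $\le_A$ is defined by: $x\le_A y$ iff every autonomous subset of $A$ containing $y$ also contains $x$. As usual $x<_A y$ means $x\le_A y$ and $x\ne y$. $(P,T)$ is strong aut descendable if the intersection of every nonempty chain (under inclusion) of autonomous sets is autonomous. For $C\subseteq P$, the contraction $P/C$ is the autonomous system with underlying set $P-C$ and autonomous sets $\{A-C : A\in T\}$. The deletion $P\backslash C$ is the autonomous system with underlying set $P-C$ and autonomous sets $\{B\subseteq P-C : B\in T\}$. A homomorphism $f$ from an autonomous system $(P,T_P)$ to an autonomous system $(Q,T_Q)$ is a function $f:P\to Q$ such that $f^{-1}(A)\in T_P$ for all $A\in T_Q$. A surjective homomorphism $f:(P,T_P)\to(Q,T_Q)$ is a quotient map if $T'\subseteq T_Q$ for every autonomous system $(Q,T')$ on the set $Q$ such that $f:(P,T_P)\to(Q,T')$ is a homomorphism; then $(Q,T_Q)$ is called a quotient of $(P,T_P)$. $Q'$ is an induced minor of $Q$ if there is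 a finite sequence $Q=Q_1,\ldots,Q_n=Q'$ of autonomous systems such that for each $1\le i<n$, $Q_{i+1}$ is $Q_i/C$ for some $C\subseteq Q_i$, or $Q_i\backslash C$ for some $C\subseteq Q_i$, or a quotient of $Q_i$. $P_4$ is the autonomous system on four distinct points $\{v_1,v_2,v_3,v_4\}$ whose autonomous sets are the sets $\{v_1,\ldots,v_i\}\cup\{v_k,\ldots,v_4\}$ with $0\le i\le 4$ and $1\le k\le 5$. An isomorphism of autonomous systems is a bijection of underlying sets under which autonomous sets correspond exactly. *)

(* Defs.v *)
From Stdlib Require Export Relation_Operators.
From mathcomp Require Export all_boot.
From mathcomp Require Export boolp classical_sets functions.
From mathcomp Require Import zify.

Set Implicit Arguments.
Unset Strict Implicit.
Unset Printing Implicit Defensive.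

Local Open Scope classical_set_scope.

Record total_order_on (T : Type) (A : set T) (le : T -> T -> Prop) : Prop := {
  tot_refl : forall x, A x -> le x x;
  tot_anti : forall x y, A x -> A y -> le x y -> le y x -> x = y;
  tot_trans : forall x y z, A x -> A y -> A z -> le x y -> le y z -> le x z;
  tot_total : total_on A le }.

Definition down_closed_in (T : Type) (A : set T) (le : T -> T -> Prop)
    (D : set T) : Prop :=
  D `<=` A /\ forall x y, D y -> A x -> le x y -> D x.

(* The whole set is not required to be autonomous: deletions need not
   preserve that property. *)
Record is_autonomous (P : Type) (T : set (set P)) : Prop := {
  autonomous_union : forall F, F `<=` T -> T (\bigcup_(A in F) A);
  autonomous_order : forall A, T A -> exists2 le : P -> P -> Prop,
    total_order_on A le & down_closed_in A le `<=` T }.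

Record autSystem := AutSystem {
  carrier :> Type;
  aut : set (set carrier);
  autP : is_autonomous aut }.

Definition canon_le (P : autSystem) (A : set P) (x y : P) : Prop :=
  forall B, aut B -> B `<=` A -> B y -> B x.

Definition canon_lt (P : autSystem) (A : set P) (x y : P) : Prop :=
  canon_le A x y /\ x <> y.

Definition strong_aut_descendable (P : autSystem) : Prop :=
  forall K : set (set P), K `<=` @aut P -> K !=set0 -> total_on K subset ->
    aut (\bigcap_(A in K) A).

(* The underlying set P - C is the subtype of points of P outside C, so the
   trace A - C of a set A is its preimage under [val]. *)
Definition contraction_aut (P : autSystem) (C : set P) :
    set (set (set_type (~` C))) :=
  [set val @^-1` A | A in @aut P].

Definition deletion_aut (P : autSystem) (C : set P) :
    set (set (set_type (~` C))) :=
  [set B | aut (val @` B)].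

Arguments contraction_aut {P} C _.
Arguments deletion_aut {P} C _.

Lemma contraction_autP (P : autSystem) (C : set P) :
  is_autonomous (contraction_aut C).
Proof.
split=> [F FT|_ [A AT <-]].
  exists (\bigcup_(A in [set A | aut A /\ F (val @^-1` A)]) A).
    by apply: (autonomous_union (autP P)) => A [].
  apply/seteqP; split=> x /=.
    by case=> A [AT FA] Ax; exists (val @^-1` A).
  by case=> S FS Sx; have [A AT AS] := FT _ FS; exists A; rewrite -?AS in FS Sx *.
have [le [rf an tr tt] dT] := autonomous_order (autP P) AT.
exists (fun x y => le (val x) (val y)).
  split=> /=.
  - by move=> x; apply: rf.
  - by move=> x y Ax Ay xy yx; apply: val_inj; apply: an.
  - by move=> x y z; apply: tr.
  - by move=> x y; apply: tt.
move=> D [DA Ddown].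
exists [set a | A a /\ exists2 d, D d & le a (val d)].
  apply: dT; split=> [a [] //|a b [Ab [d Dd bd]] Aa ab]; split=> //.
  by exists d => //; apply: (tr _ b) => //; exact: DA.
apply/seteqP; split=> x /=.
  by case=> Ax [d Dd xd]; apply: (Ddown _ d).
by move=> Dx; split; [exact: DA|exists x => //; apply: rf; exact: DA].
Qed.

Lemma deletion_autP (P : autSystem) (C : set P) :
  is_autonomous (deletion_aut C).
Proof.
split=> [F FT|A AT].
  rewrite /deletion_aut /= image_bigcup.
  rewrite (_ : \bigcup_(i in F) _ = \bigcup_(A in [set val @` B | B in F]) A).
    by apply: (autonomous_union (autP P)) => _ [B FB <-]; exact: FT.
  by rewrite bigcup_image.
have [le [rf an tr tt] dT] := autonomous_order (autP P) AT.
have im (x : set_type (~` C)) : A x -> (val @` A) (val x) by exists x.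
exists (fun x y => le (val x) (val y)).
  split=> /=.
  - by move=> x Ax; apply/rf/im.
  - by move=> x y Ax Ay xy yx; apply: val_inj; apply: an => //; exact: im.
  - by move=> x y z Ax Ay Az; apply: tr; exact: im.
  - by move=> x y Ax Ay; apply: tt; exact: im.
move=> D [DA Ddown]; apply: dT; split=> [_ [d Dd <-]|_ _ [d Dd <-] [a Aa <-] ad].
  exact/im/DA.
by exists a => //; apply: (Ddown _ d).
Qed.

Definition contraction (P : autSystem) (C : set P) : autSystem :=
  AutSystem (contraction_autP C).

Definition deletion (P : autSystem) (C : set P) : autSystem :=
  AutSystem (deletion_autP C).

Definition is_hom (P Q : Type) (TP : set (set P)) (TQ : set (set Q))
    (f : P -> Q) : Prop :=
  forall A, TQ A -> TP (f @^-1` A).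

Definition quotient_map (P Q : autSystem) (f : P -> Q) : Prop :=
  [/\ set_surj [set: P] [set: Q] f, is_hom (@aut P) (@aut Q) f &
    forall T' : set (set Q), is_autonomous T' -> is_hom (@aut P) T' f ->
      T' `<=` @aut Q].

Inductive minor_step (Q : autSystem) : autSystem -> Prop :=
| minor_contraction (C : set Q) : minor_step Q (contraction C)
| minor_deletion (C : set Q) : minor_step Q (deletion C)
| minor_quotient (Q' : autSystem) (f : Q -> Q') :
    quotient_map f -> minor_step Q Q'.

Definition induced_minor (Q Q' : autSystem) : Prop :=
  clos_refl_trans autSystem minor_step Q Q'.

Definition isomorphic (P Q : autSystem) : Prop :=
  exists2 f : P -> Q, bijective f & forall A : set P, aut A <-> aut (f @` A).

(* The ordinal [v : 'I_4] stands for the point v_(v+1). *)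
Definition P4_set (i k : nat) : set 'I_4 :=
  [set v | (v.+1 <= i)%N \/ (k <= v.+1)%N].

Definition P4_aut : set (set 'I_4) :=
  [set S | exists i k : nat, [/\ (0 <= i <= 4)%N, (1 <= k <= 5)%N &
    S = P4_set i k]].

Lemma P4_autP : is_autonomous P4_aut.
Proof.
split=> [F FT|_ [i [k [/= i4 k15 ->]]]].
  set U := \bigcup_(A in F) A.
  pose p n := (n <= 4)%N && `[< forall v : 'I_4, (v.+1 <= n)%N -> U v >].
  pose q n := (1 <= n <= 5)%N && `[< forall v : 'I_4, (n <= v.+1)%N -> U v >].
  have p0 : exists n, p n by exists 0; apply/asboolP.
  have q5 : exists n, q n.
    by exists 5; apply/asboolP => v; rewrite ltnNge ltn_ord.
  have pb n : p n -> (n <= 4)%N by case/andP.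
  case: (ex_maxnP p0 pb) => n /andP[n4 /asboolP nU] nmax.
  case: (ex_minnP q5) => m /andP[m15 /asboolP mU] mmin.
  exists n, m; split=> //; apply/seteqP; split=> v /=; last first.
    by case; [exact: nU|exact: mU].
  case=> A FA Av; have [i [k [/= i4 k15 AE]]] := FT _ FA.
  move: (Av); rewrite AE => -[vi|kv]; [left|right].
    apply: leq_trans vi (nmax _ _); rewrite /p i4; apply/asboolP => w wi.
    by exists A => //; rewrite AE; left.
  apply: leq_trans (mmin _ _) kv; rewrite /q k15; apply/asboolP => w wi.
  by exists A => //; rewrite AE; right.
pose key (v : 'I_4) := if (v < i)%N then val v else 7 - v.
have keylt (v : 'I_4) : (v < i)%N -> key v = v by rewrite /key => ->.
have keyge (v : 'I_4) : (i <= v)%N -> key v = 7 - v by rewrite /key ltnNge => ->.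
have key4 (v : 'I_4) : (i <= v)%N -> (4 <= key v)%N.
  by move=> /keyge ->; case: v => -[|[|[|[|]]]].
have keyinj : injective key.
  move=> v w h; apply: val_inj; move: h (ltn_ord v) (ltn_ord w); rewrite /key /=.
  by do 2 case: ifP; lia.
exists (fun v w => (key v <= key w)%N).
  split=> /=.
  - by move=> v _; exact: leqnn.
  - by move=> v w _ _ vw wv; apply: keyinj; apply/eqP; rewrite eqn_leq vw.
  - by move=> u v w _ _ _; exact: leq_trans.
  - by move=> v w _ _; apply/orP; exact: leq_total.
move=> D [DA Ddown].
have [[d [Dd id]]|Dlt] := pselect (exists d, D d /\ (i <= d)%N).
  pose q n := `[< exists d : 'I_4, [/\ D d, (i <= d)%N & d = n :> nat] >].
  have qd : exists n, q n by exists d; apply/asboolP; exists d.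
  case: (ex_minnP qd) => m /asboolP[e [De ie em]] mmin.
  have ke : (k <= e.+1)%N by case: (DA _ De) => //; rewrite ltnNge ie.
  exists i, m.+1; split=> //; first by rewrite -em /= ltnS ltnW.
  apply/seteqP; split=> v /=.
    move=> Dv; case: (ltnP v i) => [|iv]; [by left|right].
    by rewrite ltnS; apply: mmin; apply/asboolP; exists v.
  case: (ltnP v i) => [vi _|iv].
    apply: (Ddown _ e) => //; first by left.
    by rewrite keylt//; apply: leq_trans _ (key4 _ ie); rewrite ltnW.
  case=> [|mv]; first by rewrite ltnNge iv.
  apply: (Ddown _ e) => //; first by right; rewrite (leq_trans ke)// em.
  by rewrite !keyge// leq_sub2l// em.
pose p n := `[< forall d : 'I_4, D d -> (d < n)%N >].
have Di d : D d -> (d < i)%N.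
  by move=> Dd; rewrite ltnNge; apply/negP => id; apply: Dlt; exists d.
have pi : p i by apply/asboolP.
have pex : exists n, p n by exists i.
case: (ex_minnP pex) => n /asboolP nD nmin.
have ni := nmin _ pi.
exists n, 5; split=> //; first exact: leq_trans ni i4.
apply/seteqP; split=> v /=; first by move/nD; left.
case=> [vn|]; last by rewrite ltnNge ltn_ord.
have [//|Dv] := pselect (D v).
suff /nmin : p v by rewrite leqNgt vn.
apply/asboolP => d Dd; rewrite ltnNge; apply/negP => vd; apply: Dv.
have vi : (v < i)%N by apply: leq_trans vn ni.
by apply: (Ddown _ d) => //; [left|rewrite (keylt v vi) (keylt d (Di _ Dd))].
Qed.

Definition P4 : autSystem := AutSystem P4_autP.

(* Main.v *)
(* For a set W of points let [interior W] be the largest autonomous subset of W.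
   Put M = interior (A \ x) and N = A \ (M + x); then y lies in N.  With
   Z = B \ N, the family of all G included in N with x in interior (Z + G) is
   closed under intersections of chains (strong descendability), contains N but
   not the empty set.  A compactness argument therefore gives a point z of N and
   a G in this family such that G contains every element of N up to z in an order
   of A, while G \ z is no longer in the family.  Let W = Z + G and cut A down to
   M, x and the points of N up to z: every autonomous subset of W containing x now
   contains z.

   Writing y for z, set U = interior (W \ x), R = interior (W \ {x, y}) and
   E = interior ((A + U) \ {x, y} \ (R \ A)).  Delete everything outside A + U,
   keep the four disjoint sets M \ U, x + (E \ A), {y}, R \ A, contract the rest
   and collapse each of the four sets to a point.  The autonomous sets M,
   E + (A \ y), E + A and R, R + y, U + x yield the prefixes and suffixes of P_4. *)

Require Import Defs.
From mathcomp Require Import all_boot boolp classical_sets functions.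

Set Implicit Arguments.
Unset Strict Implicit.
Unset Printing Implicit Defensive.

Local Open Scope classical_set_scope.

(** * Largest autonomous subsets *)

Definition interior (P : autSystem) (W : set P) : set P :=
  \bigcup_(S in [set S | aut S /\ S `<=` W]) S.

Lemma interior_aut (P : autSystem) (W : set P) : aut (interior W).
Proof. by apply: (autonomous_union (autP P)) => S []. Qed.

Lemma interior_sub (P : autSystem) (W : set P) : interior W `<=` W.
Proof. by move=> p [S [_ SW] Sp]; exact: SW. Qed.

Lemma sub_interior (P : autSystem) (W S : set P) :
  aut S -> S `<=` W -> S `<=` interior W.
Proof. by move=> AS SW p Sp; exists S. Qed.

Lemma autU (P : autSystem) (S S' : set P) : aut S -> aut S' -> aut (S `|` S').
Proof.
move=> AS AS'.
have -> : S `|` S' = \bigcup_(A in [set S; S']) A.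
  by rewrite bigcup_setU !bigcup_set1.
by apply: (autonomous_union (autP P)) => _ [] ->.
Qed.

(** In an order of [S] given by the order property, the points strictly below [x] and the points up
    to [x] both form down-sets. *)
Lemma aut_below (P : autSystem) (S : set P) (x : P) : aut S -> S x ->
  exists S', [/\ aut S', S' `<=` S, ~ S' x & aut (x |` S')].
Proof.
move=> AS Sx; have [le [rf an tr tt] dT] := autonomous_order (autP P) AS.
exists [set s | [/\ S s, le s x & s <> x]]; split.
- apply: dT; split=> [s []//|a b [Sb bx nbx] Sa ab]; split=> //.
    exact: (tr a b x).
  by move=> ax; apply: nbx; apply: an => //; rewrite -ax.
- by move=> s [].
- by case.
- have -> : x |` [set s | [/\ S s, le s x & s <> x]] = [set s | S s /\ le s x].
    apply/seteqP; split=> s /=.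
      by case=> [->|[]]; split=> //; exact: rf.
    by case=> Ss sx; have [->|sx'] := pselect (s = x); [left|right].
  apply: dT; split=> [s []//|a b [Sb bx] Sa ab]; split=> //.
  exact: (tr a b x).
Qed.

(** The part of [S] below [x] found by [aut_below] already lies in [interior W], so a union of two
    autonomous sets suffices. *)
Lemma interior_setU1 (P : autSystem) (W S : set P) (x : P) :
  aut S -> S x -> S `<=` x |` W -> aut (x |` interior W).
Proof.
move=> AS Sx SW; have [S' [AS' S'S S'x AxS']] := aut_below AS Sx.
have S'W : S' `<=` interior W.
  apply: sub_interior => // s S's; have [sx|//] := SW _ (S'S _ S's).
  by case: S'x; rewrite -sx.
have -> : x |` interior W = interior W `|` (x |` S').
  by rewrite setUCA (setUidl S'W).
by apply: autU => //; exact: interior_aut.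
Qed.

(** * Critical points by compactness *)

Lemma min_in_seq (T : eqType) (N : set T) (le : T -> T -> Prop) (s : seq T) :
  total_order_on N le -> (exists2 z, z \in s & N z) ->
  exists y, [/\ y \in s, N y & forall z, z \in s -> N z -> le y z].
Proof.
move=> [rf an tr tt]; elim: s => [[z]//|a s IH] [z0 z0s Nz0].
have [/IH[y [ys Ny ymin]]|Ns] := pselect (exists2 z, z \in s & N z); last first.
  have sN z : z \in a :: s -> N z -> z = a.
    rewrite inE => /orP[/eqP//|zs Nz]; case: Ns; by exists z.
  have Na : N a by rewrite -(sN _ z0s Nz0).
  exists a; rewrite mem_head; split=> // z zs Nz; rewrite (sN _ zs Nz).
  exact: rf.
have [[Na ay]|nay] := pselect (N a /\ le a y).
  exists a; rewrite mem_head; split=> // z; rewrite inE => /orP[/eqP->|zs] Nz.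
    exact: rf.
  by apply: (tr a y z) => //; exact: ymin.
exists y; rewrite inE ys orbT; split=> // z; rewrite inE => /orP[/eqP->|zs] Nz.
  by have [//|ay] := tt _ _ Ny Nz; case: nay.
exact: ymin.
Qed.

(** [le] need not be a well-order, so points cannot simply be removed by transfinite recursion along
    it. Instead, without a critical pair, finite removals and Zorn's lemma would exhaust [N],
    against [~ J set0]. *)
Lemma exists_critical_point (T : eqType) (N : set T) (le : T -> T -> Prop)
    (J : set (set T)) :
  total_order_on N le ->
  (forall K, K `<=` J -> K !=set0 -> total_on K subset ->
    J (\bigcap_(A in K) A)) ->
  J N -> ~ J set0 ->
  exists y G, [/\ N y, G `<=` N, forall z, N z -> le z y -> G z, J G &
    ~ J (G `\ y)].
Proof.
move=> leN Jcap JN J0; apply: contrapT => nocrit.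
have [rf an tr tt] := leN.
(* Delete the points of s one at a time, each time the le-largest one left, so
   that all elements below the deleted point are still there. *)
have Jfin (s : seq T) : J (N `\` [set` s]).
  have [n] := ubnP (size s); elim: n s => // n IH s sn.
  have [exs|nos] := pselect (exists2 z, z \in s & N z); last first.
    rewrite (_ : _ `\` _ = N)//; apply/seteqP; split=> [z []//|z Nz].
    by split=> //= zs; apply: nos; exists z.
  have [y [ys Ny ymin]] := min_in_seq leN exs.
  pose s' := [seq z <- s | z != y].
  have Js' : J (N `\` [set` s']).
    apply: IH; rewrite size_filter; apply: leq_trans (sn : (size s <= n)%N).
    by rewrite -(count_predC (pred1 y)) -add1n leq_add2r -has_count has_pred1.
  apply: contrapT => nJs; apply: nocrit; exists y, (N `\` [set` s']); split=> //.
  - move=> z Nz zy; split=> //=; rewrite mem_filter => /andP[/eqP zny zs].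
    by apply: zny; apply: an => //; exact: ymin.
  - rewrite (_ : _ `\ y = N `\` [set` s])//.
    apply/seteqP; split=> z /=.
      case=> -[Nz zs'] zy; split=> // zs; apply: zs'.
      by rewrite mem_filter zs andbT; apply/eqP.
    case=> Nz zs; split; last by move=> zy; rewrite zy in zs.
    by split=> //; rewrite mem_filter => /andP[].
(* Passing from finite sets to all sets: finite removals stay possible after a
   maximal removal R, which therefore cannot miss a point. *)
pose removable := [set R : set T | forall s : seq T, J (N `\` R `\` [set` s])].
have [F FR Ftot|R [RR Rmax]] := @Zorn_bigcup T removable.
  (* The empty chain is handled by [Jfin]; for a nonempty one the remainders form a chain again, and
     [Jcap] applies. *)
  move=> s; have [[R0 FR0]|F0] := pselect (F !=set0); last first.
    rewrite (_ : bigcup _ _ = set0) ?setD0//.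
    by apply/seteqP; split=> // z [R FR'] _; case: F0; exists R.
  rewrite (_ : _ `\` _ = \bigcap_(A in [set N `\` R `\` [set` s] | R in F]) A).
    apply: Jcap; first by move=> _ [R FR' <-]; exact: (FR _ FR' s).
      by exists (N `\` R0 `\` [set` s]); exists R0.
    move=> _ _ [R1 F1 <-] [R2 F2 <-].
    by have [R12|R21] := Ftot _ _ F1 F2; [right|left]; apply: setSD; exact: setDS.
  apply/seteqP; split=> z /=.
    case=> -[Nz Fz] sz _ [R FR' <-]; split=> //; split=> // Rz.
    by apply: Fz; exists R.
  move=> Hz; have [[Nz _] sz] : (N `\` R0 `\` [set` s]) z.
    by apply: Hz; exists R0.
  split=> //; split=> // -[R FR' Rz].
  by have [[]] : (N `\` R `\` [set` s]) z by apply: Hz; exists R.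
have RT z : R z.
  apply: contrapT => nRz; apply: (Rmax (z |` R)).
    by split; [exact: subsetUr|move=> /(_ z (or_introl erefl))].
  move=> s; have := RR (z :: s).
  rewrite (_ : _ `\` _ = N `\` (z |` R) `\` [set` s])//.
  apply/seteqP; split=> w /=.
    case=> -[Nw Rw] /negP; rewrite inE negb_or => /andP[/eqP wz /negP ws].
    by split=> //; split=> // -[].
  case=> -[Nw zRw] ws; split; first by split=> // Rw; apply: zRw; right.
  by rewrite inE => /orP[/eqP wz|//]; apply: zRw; left.
apply: J0; have := RR [::]; rewrite (_ : _ `\` _ = set0)//.
by apply/seteqP; split=> // z [[_ /(_ (RT z))]].
Qed.

(** * Recognizing P_4 as a minor *)

(* [traceable F V f D]: deleting the complement of F and contracting F \ V gives
   a system in which the preimage of D under f is autonomous. *)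
Definition traceable (P : autSystem) (F V : set P) (f : P -> 'I_4)
    (D : set 'I_4) : Prop :=
  exists2 S : set P, aut S /\ S `<=` F & forall p, V p -> S p <-> D (f p).

Lemma traceableU (P : autSystem) (F V : set P) (f : P -> 'I_4) (D E : set 'I_4) :
  traceable F V f D -> traceable F V f E -> traceable F V f (D `|` E).
Proof.
move=> [S [AS SF] SD] [S' [AS' SF'] SD']; exists (S `|` S').
  by split; [exact: autU|rewrite subUset].
by move=> p Vp; rewrite /setU/= SD// SD'.
Qed.

Definition v1 : 'I_4 := @Ordinal 4 0 isT.
Definition v2 : 'I_4 := @Ordinal 4 1 isT.
Definition v3 : 'I_4 := @Ordinal 4 2 isT.
Definition v4 : 'I_4 := @Ordinal 4 3 isT.

Lemma I4P (v : 'I_4) : [\/ v = v1, v = v2, v = v3 | v = v4].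
Proof.
case: v => -[|[|[|[|//]]]] h; [apply: Or41|apply: Or42|apply: Or43|apply: Or44];
  exact: val_inj.
Qed.

Lemma set_I4P (D E : set 'I_4) :
  (D v1 <-> E v1) -> (D v2 <-> E v2) -> (D v3 <-> E v3) -> (D v4 <-> E v4) ->
  D = E.
Proof.
by move=> h1 h2 h3 h4; apply/predeqP => v; have [->|->|->|->] := I4P v.
Qed.

Ltac decide_I4 := apply: set_I4P;
  first [by split=> // _; left|by split=> // _; right|by split=> // -[]|by split].

(** Five of the sixteen subsets are missing from [P4_aut]: the four excluded by hypothesis and
    [[set v2; v3]]. If the last were in [T], the order property would put the singleton of its lower
    point in [T]. *)
Lemma sub_P4_aut (T : set (set 'I_4)) : is_autonomous T ->
  ~ T [set v2] -> ~ T [set v3] ->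
  ~ T [set v2; v4] -> ~ T [set v1; v3] -> T `<=` P4_aut.
Proof.
move=> TP T2 T3 T24 T13 D TD.
have P4D i k : (i <= 4)%N -> (1 <= k <= 5)%N -> D = P4_set i k -> P4_aut D.
  by move=> i4 k15 ->; exists i, k.
have T23 : ~ T [set v2; v3].
  move=> {}/(autonomous_order TP)[le [rf an tr tt] dT].
  have [l23|l32] := tt v2 v3 (or_introl erefl) (or_intror erefl).
    apply: T2; apply: dT; split=> [_ ->|a b -> [//|->] l32]; first by left.
    by apply: an => //; [right|left].
  apply: T3; apply: dT; split=> [_ ->|a b -> [->|//] l23]; first by right.
  by apply: an => //; [left|right].
have TE E : D = E -> T E by move=> <-.
have [D1|D1] := pselect (D v1); have [D2|D2] := pselect (D v2);
  have [D3|D3] := pselect (D v3); have [D4|D4] := pselect (D v4).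
- by apply: (P4D 4 5) => //; decide_I4.
- by apply: (P4D 3 5) => //; decide_I4.
- by apply: (P4D 2 4) => //; decide_I4.
- by apply: (P4D 2 5) => //; decide_I4.
- by apply: (P4D 1 3) => //; decide_I4.
- by case: T13; apply: TE; decide_I4.
- by apply: (P4D 1 4) => //; decide_I4.
- by apply: (P4D 1 5) => //; decide_I4.
- by apply: (P4D 0 2) => //; decide_I4.
- by case: T23; apply: TE; decide_I4.
- by case: T24; apply: TE; decide_I4.
- by case: T2; apply: TE; decide_I4.
- by apply: (P4D 0 3) => //; decide_I4.
- by case: T3; apply: TE; decide_I4.
- by apply: (P4D 0 4) => //; decide_I4.
- by apply: (P4D 0 5) => //; decide_I4.
Qed.

(** Unions of prefixes and suffixes give the homomorphism to [P4]. For the quotient property two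
    forbidden sets suffice: [[set v2]] joined with the suffix [[set v4]], or [[set v3]] with the
    prefix [[set v1]], would produce one of them. *)
Lemma induced_minor_P4 (P : autSystem) (F V : set P) (f : P -> 'I_4) :
  V `<=` F -> (forall i, exists2 p, V p & f p = i) ->
  (forall i, (1 <= i <= 3)%N -> traceable F V f (P4_set i 5)) ->
  (forall k, (2 <= k <= 4)%N -> traceable F V f (P4_set 0 k)) ->
  ~ traceable F V f [set v2; v4] ->
  ~ traceable F V f [set v1; v3] ->
  induced_minor P P4.
Proof.
move=> VF fV prefix suffix N24 N13.
pose Q1 := deletion (~` F).
pose Q2 := contraction [set q : Q1 | ~ V (val q)].
pose g (q : Q2) : P4 := f (val (val q)).
have FC p : F p -> p \in ~` (~` F) by move=> Fp; apply: mem_set; rewrite setCK.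
have VC (q : Q1) : V (val q) -> q \in ~` [set q : Q1 | ~ V (val q)].
  by move=> Vq; apply/mem_set => /=.
have Q1F (q : Q1) : F (val q) by apply: contrapT; exact: (set_valP q).
have Q2V (q : Q2) : V (val (val q)) by apply: contrapT; exact: (set_valP q).
have traceP (D : set 'I_4) : aut (g @^-1` D) <-> traceable F V f D.
  split.
    move=> [S /= AS SD]; exists [set val q | q in S].
      by split=> // _ [q Sq <-].
    move=> p Vp; pose q1 : Q1 := SigSub (FC _ (VF _ Vp)).
    pose q2 : Q2 := SigSub (VC q1 Vp).
    have -> : D (f p) = (g @^-1` D) q2 by [].
    rewrite -SD /=; split; last by exists q1.
    by case=> q Sq qp; rewrite (_ : q1 = q)//; apply: val_inj.
  move=> [S [AS SF] SD]; exists [set q : Q1 | S (val q)].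
    rewrite /= /deletion_aut /= (_ : [set _ | _ in _] = S)//.
    apply/seteqP; split=> [_ [q Sq <-]//|p Sp].
    by exists (SigSub (FC _ (SF _ Sp))).
  apply/seteqP; split=> q /=; by rewrite SD//; exact: Q2V.
have surj : set_surj [set: Q2] [set: P4] g.
  move=> i _; have [p Vp <-] := fV i.
  by exists (SigSub (VC (SigSub (FC _ (VF _ Vp))) Vp)).
(* The empty and full sets cover the cases [i] = 0, 4 and [k] = 5, 1 left out by [prefix] and
   [suffix]. *)
have trace0 : traceable F V f set0.
  exists set0; last by [].
  by split=> //; rewrite -(bigcup_set0 id); exact: (autonomous_union (autP P)).
have traceT : traceable F V f setT.
  rewrite (_ : setT = P4_set 3 5 `|` P4_set 0 2).
    by apply: traceableU; [exact: prefix|exact: suffix].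
  by apply: set_I4P; split=> // _; by [do 2 left|right; right].
have homg : is_hom (@aut Q2) (@aut P4) g.
  move=> D [i [k [/andP[_ i4] /andP[k1 k5] ->]]]; apply/traceP.
  have -> : P4_set i k = P4_set i 5 `|` P4_set 0 k.
    apply/seteqP; split=> v; rewrite /P4_set /=.
      by case=> h; [left; left|right; right].
    by case=> [[|]|[|]]// h; [left|move: h; rewrite ltnNge ltn_ord|right].
  apply: traceableU.
    case: i i4 => [_|[|[|[|[|//]]]] _]; [|exact: prefix..|].
      by rewrite (_ : P4_set _ _ = set0)//; decide_I4.
    by rewrite (_ : P4_set _ _ = setT)//; decide_I4.
  case: k k1 k5 => [//|[|[|[|[|[|//]]]]]] _ _; [|exact: suffix..|].
    by rewrite (_ : P4_set _ _ = setT)//; decide_I4.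
  by rewrite (_ : P4_set _ _ = set0)//; decide_I4.
apply: (@rt_trans _ _ _ Q1); first by apply: rt_step; exact: minor_deletion.
apply: (@rt_trans _ _ _ Q2); first by apply: rt_step; exact: minor_contraction.
apply/rt_step/(@minor_quotient _ _ g); split=> // T' T'P T'hom.
have T'tr D : T' D -> traceable F V f D by move=> /T'hom /traceP.
apply: sub_P4_aut => // [/T'tr tr2|/T'tr tr3|/T'tr//|/T'tr//].
  apply: N24; rewrite (_ : [set v4] = P4_set 0 4); last by decide_I4.
  by apply: traceableU => //; exact: suffix.
apply: N13; rewrite setUC (_ : [set v1] = P4_set 1 5); last by decide_I4.
by apply: traceableU => //; exact: prefix.
Qed.

(** * Building P_4 from a conflict *)

(** The conflict: autonomous subsets of [W] containing [x] contain [y], those of [A] containing [y]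
    contain [x]. Autonomy of [A] without [y] serves to separate the prefixes ending at [v2] and
    [v3]. *)
Lemma induced_minor_P4_of_conflict (P : autSystem) (A M W : set P) (x y : P) :
  aut A -> aut M -> aut (x |` M) -> aut (A `\ y) -> M `<=` A `\ y ->
  A x -> ~ M x -> A y -> x <> y ->
  (forall S, aut S -> S `<=` A -> ~ S x -> S `<=` M) ->
  A `\` M `<=` W ->
  interior W x -> ~ interior (W `\ y) x ->
  induced_minor P P4.
Proof.
move=> autA autM autxM autAy MA Ax nMx Ay xy Mmax ANW [S0 [autS0 S0W] S0x] nWy.
have Wx : W x by exact: S0W.
have nMy : ~ M y by move=> /MA[_]; apply.
have Wy : W y by apply: ANW.
have Wxy S : aut S -> S `<=` W -> S x -> S y.
  move=> autS SW Sx; apply: contrapT => nSy; apply: nWy.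
  by apply: (sub_interior autS _ Sx) => p Sp; split;
    [exact: SW|move=> py; apply: nSy; rewrite -py].
pose U := interior (W `\ x); pose R := interior (W `\ x `\ y).
have autonU : aut U := interior_aut _.
have UW p : U p -> W p by move=> /interior_sub[].
have nUx : ~ U x by move=> /interior_sub[_]; apply.
have autxU : aut (x |` U).
  apply: (interior_setU1 autS0 S0x) => p /S0W Wp.
  by have [->|px] := pselect (p = x); [left|right].
have Uy : U y.
  have [yx|//] : (x |` U) y; last by case: xy.
  by apply: (Wxy _ autxU) => [p [->|/UW]|]//; left.
have RU : R `<=` U.
  by apply: sub_interior; [exact: interior_aut|move=> p /interior_sub[]].
have nRy : ~ R y by move=> /interior_sub[_]; apply.
have autyR : aut (y |` R).
  apply: (interior_setU1 autonU Uy) => p /interior_sub Up.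
  by have [->|py] := pselect (p = y); [left|right].
pose F := A `|` U; pose V4 := R `\` A; pose V1 := M `\` U.
pose E := interior (F `\ x `\ y `\` V4); pose X := x |` (E `\` A).
have EF p : E p -> [/\ F p, p <> x, p <> y & ~ V4 p].
  by move=> /interior_sub[[[]]].
have autE : aut E := interior_aut _.
(* Only the values on [V] matter for [traceable]. *)
pose f p := if `[< X p >] then v2 else if `[< p = y >] then v3
  else if `[< A p >] then v1 else v4.
pose V := V1 `|` X `|` [set y] `|` V4.
have nXy : ~ X y by move=> [yx|[_ []//]]; case: xy.
have nXM p : M p -> ~ X p.
  by move=> Mp [px|[_ []]]; [case: nMx; rewrite -px|exact: (MA _ Mp).1].
have nX4 p : V4 p -> ~ X p.
  by move=> V4p [px|[/EF[]//]]; case: V4p => _ []; rewrite px.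
have fX p : X p -> f p = v2 by move=> Xp; rewrite /f asboolT.
have fy : f y = v3 by rewrite /f asboolF// asboolT.
have f1 p : V1 p -> f p = v1.
  move=> [Mp _]; have [Ap py] := MA _ Mp.
  by rewrite /f (asboolF (nXM _ Mp)) (asboolF py) (asboolT Ap).
have f4 p : V4 p -> f p = v4.
  move=> V4p; have [_ nAp] := V4p.
  have py : p <> y by move=> py; apply: nAp; rewrite py.
  by rewrite /f (asboolF (nX4 _ V4p)) (asboolF py) (asboolF nAp).
have trace S D : aut S -> S `<=` F -> (forall p, V1 p -> S p <-> D v1) ->
    (forall p, X p -> S p <-> D v2) -> (S y <-> D v3) ->
    (forall p, V4 p -> S p <-> D v4) -> traceable F V f D.
  move=> autS SF S1 S2 S3 S4; exists S => // p [[[V1p|Xp]|->]|V4p].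
  - by rewrite f1//; exact: S1.
  - by rewrite fX//; exact: S2.
  - by rewrite fy.
  - by rewrite f4//; exact: S4.
have MsF : M `<=` F by move=> p /MA[Ap _]; left.
have AF : A `<=` F by move=> p; left.
have UF : U `<=` F by move=> p; right.
have RF : R `<=` F by move=> p /RU; right.
have XF : X `<=` F by move=> p [->|[/EF[]//]]; left.
have X_xE p : X p -> (E `|` (A `\ y)) p.
  by case=> [->|[Ep _]]; [right|left].
have XU p : X p -> (x |` U) p.
  by case=> [->|[/EF[[|]]]]; [left| |right].
have prefix i : (1 <= i <= 3)%N -> traceable F V f (P4_set i 5).
  case: i => [//|[|[|[|//]]]] _.
  - apply: (trace M) => //.
    + by move=> p [Mp _]; split=> // _; left.
    + by move=> p Xp; split=> [/nXM//|[]].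
    + by split=> // -[].
    + by move=> p [_ nAp]; split=> [/MA[]//|[]].
  - apply: (trace (E `|` (A `\ y))).
    + exact: autU.
    + by move=> p [/EF[]//|[Ap _]]; left.
    + move=> p [Mp _]; split=> [_|_]; [by left|right; exact: MA].
    + by move=> p /X_xE; split=> // _; left.
    + by split=> [[/EF[]//|[_ []]]|[]].
    + by move=> p V4p; split=> [[/EF[]//|[Ap _]]|[]//]; case: V4p.
  - apply: (trace (E `|` A)).
    + exact: autU.
    + by move=> p [/EF[]//|Ap]; left.
    + by move=> p [/MA[Ap _] _]; split=> _; [left|right].
    + by move=> p /X_xE[Ep|[Ap _]]; split=> // _; by [left|right|left].
    + by split=> _; [left|right].
    + by move=> p V4p; split=> [[/EF[]//|Ap]|[]//]; case: V4p.
have suffix k : (2 <= k <= 4)%N -> traceable F V f (P4_set 0 k).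
  case: k => [//|[//|[|[|[|//]]]]] _.
  - apply: (trace (x |` U)) => //.
    + by move=> p [->|/UF//]; left.
    + move=> p [Mp nUp]; split=> [[px|//]|[]//]; case: nMx; by rewrite -px.
    + by move=> p Xp; split=> _; [right|exact: XU].
    + by split=> _; right.
    + by move=> p [/RU Up _]; split=> _; right.
  - apply: (trace (y |` R)) => //.
    + by move=> p [->|/RF//]; left.
    + move=> p [Mp nUp]; split=> [[py|/RU//]|[]//]; case: nMy; by rewrite -py.
    + move=> p Xp; split=> [[py|Rp]|[]//]; first by case: nXy; rewrite -py.
      (* A point of [R] outside [A] lies in [V4], which [E] avoids. *)
      case: Xp => [px|[/EF[_ _ _ nV4p] nAp]]; last by case: nV4p.
      by case: nUx; rewrite -px; exact: RU.
    + by split=> _; [right|left].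
    + by move=> p [Rp _]; split=> _; right.
  - apply: (trace R) => //.
    + exact: interior_aut.
    + by move=> p [Mp nUp]; split=> [/RU//|[]//].
    + move=> p Xp; split=> [Rp|[]//].
      case: Xp => [px|[/EF[_ _ _ nV4p] nAp]]; last by case: nV4p.
      by case: nUx; rewrite -px; exact: RU.
    + by split=> // -[].
    + by move=> p [Rp _]; split=> // _; right.
have V1V p : V1 p -> V p by move=> ?; left; left; left.
have XV p : X p -> V p by move=> ?; left; left; right.
have yV : V y by left; right.
have V4V p : V4 p -> V p by move=> ?; right.
have Xx : X x by left.
apply: (@induced_minor_P4 P F V f) => //.
- by move=> p [[[[/MsF]|/XF]|->]|[/RF]] => //; left.
(* Otherwise [M] lies in [U], so [M] with [x] is an autonomous subset of [W] and must contain
   [y]. *)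
- have [p V1p] : V1 !=set0.
    apply: contrapT => nV1; case: xy.
    have [//|/nMy//] : (x |` M) y.
    apply: (Wxy _ autxM) => [p [->//|Mp]|]; last by left.
    by apply: UW; apply: contrapT => nUp; apply: nV1; exists p.
  (* Otherwise [R] with [y] is an autonomous subset of [A] avoiding [x], hence inside [M]. *)
  have [q V4q] : V4 !=set0.
    apply: contrapT => nV4; apply: nMy.
    apply: (Mmax (y |` R)) => //; last by left.
      move=> q [->//|Rq]; apply: contrapT => nAq.
      by apply: nV4; exists q.
    by move=> [//|/RU].
  move=> i; have [->|->|->|->] := I4P i.
  + by exists p; [exact: V1V|exact: f1].
  + by exists x; [exact: XV|exact: fX].
  + by exists y.
  + by exists q; [exact: V4V|exact: f4].
(* A trace [S] of [[set v2; v4]] misses [V1] and so lies in [W]; as it contains [x], it contains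
   [y]. *)
- move=> [S [autS SF] SD].
  have nSy : ~ S y by rewrite (SD _ yV) fy => -[].
  apply: nSy; apply: Wxy => //; last by rewrite SD ?fX//; [left|exact: XV].
  move=> p Sp; case: (SF _ Sp) => [Ap|/UW//].
  have [Mp|nMp] := pselect (M p); last exact: ANW.
  apply: UW; apply: contrapT => nUp.
  by move: Sp; rewrite (SD p) ?f1//; [case|exact: V1V].
(* For [[set v1; v3]], the part [S'] of [S] below [y] fits into [E], so its points outside [A] would
   lie in [X], which [S] misses. Hence [S'] with [y] is an autonomous subset of [A] avoiding [x]. *)
- move=> [S [autS SF] SD].
  have Sy : S y by rewrite (SD _ yV) fy; right.
  have [S' [autS' S'S nS'y autyS']] := aut_below autS Sy.
  have S'E : S' `<=` E.
    apply: sub_interior => // p S'p; have Sp := S'S _ S'p.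
    split; [split; [split|]|] => [||py|V4p] /=.
    + exact: SF.
    + move=> px; move: Sp; rewrite px (SD _ (XV _ Xx)) fX//; by case.
    + by apply: nS'y; rewrite -py.
    + by move: Sp; rewrite (SD _ (V4V _ V4p)) f4//; case.
  apply: nMy; apply: (Mmax (y |` S')) => //; last by left.
    move=> p [->//|S'p]; apply: contrapT => nAp.
    have Xp : X p by right; split=> //; exact: S'E.
    by have := S'S _ S'p; rewrite (SD _ (XV _ Xp)) fX//; case.
  by move=> [//|/S'E/EF[]].
Qed.

(** * Reduction to a conflict at a critical point *)

Theorem theorem28 (P : autSystem) (PT : aut [set: P])
    (desc : strong_aut_descendable P)
    (A B : set P) (AT : aut A) (BT : aut B)
    (x y : P) (xAB : (A `&` B) x) (yAB : (A `&` B) y)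
    (xyA : canon_lt A x y) (yxB : canon_lt B y x) :
  exists2 Q : autSystem, induced_minor P Q & isomorphic Q P4.
Proof.
exists P4; last first.
  by exists id; [exists id|move=> D; rewrite image_id].
case: xAB => Ax Bx; case: yAB => Ay By.
pose M := interior (A `\ x).
have autM : aut M := interior_aut _.
have MA : M `<=` A `\ x := @interior_sub _ _.
have autxM : aut (x |` M).
  apply: (interior_setU1 AT Ax) => p Ap.
  by have [->|px] := pselect (p = x); [left|right].
have nMx : ~ M x by move=> /MA[_]; apply.
have Mmax S : aut S -> S `<=` A -> ~ S x -> S `<=` M.
  move=> autS SA nSx; apply: sub_interior => // p Sp; split; first exact: SA.
  by move=> px; apply: nSx; rewrite -px.
pose N := A `\` M `\ x; pose Z := B `\` N.
have Ny : N y.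
  split; last by move=> yx; case: yxB.
  split=> // My; apply: nMx; apply: (xyA.1) My => //; exact: subset_trans MA _.
have [le leA dT] := autonomous_order (autP P) AT.
have [rf an tr tt] := leA.
have NA : N `<=` A by move=> p [[]].
have leN : total_order_on N le.
  split.
  - by move=> p /NA; exact: rf.
  - by move=> p q /NA Ap /NA; exact: an.
  - by move=> p q r /NA Ap /NA Aq /NA; exact: tr.
  - by move=> p q /NA Ap /NA; exact: tt.
pose J := [set G : set P | interior (Z `|` G) x].
have [|||z [G [Nz GN Gz JG nJG]]] :=
    @exists_critical_point {classic P} N le J leN.
- move=> K KJ [G0 KG0] Ktot.
  (* The intersection of these nested interiors is autonomous by descendability, and lies in the
     union of [Z] with the intersection of [K]. *)
  pose I := [set interior (Z `|` G) | G in K].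
  have autI : aut (\bigcap_(S in I) S).
    apply: desc.
    + by move=> _ [G _ <-]; exact: interior_aut.
    + by exists (interior (Z `|` G0)); exists G0.
    + have mono G1 G2 : G1 `<=` G2 -> interior (Z `|` G1) `<=` interior (Z `|` G2).
        move=> G12; apply: sub_interior; first exact: interior_aut.
        by apply: subset_trans (@interior_sub _ _) _; exact: setUS.
      move=> _ _ [G1 K1 <-] [G2 K2 <-].
      by have [/mono|/mono] := Ktot _ _ K1 K2; [left|right].
  apply: (sub_interior autI); last by move=> _ [G KG <-]; exact: KJ.
  move=> p Ip; have [Zp|nZp] := pselect (Z p); [by left|right=> G KG].
  have /interior_sub[//|//] : interior (Z `|` G) p by apply: Ip; exists G.
- apply: (sub_interior BT _ Bx) => p Bp.
  by have [Np|nNp] := pselect (N p); [right|left].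
(* By [yxB], an autonomous subset of [Z] containing [x] would contain [y], which lies in [N]. *)
- rewrite /J/= setU0 => -[S [autS SZ] Sx].
  have /SZ[_]: S y by apply: (yxB.1) Sx => // p /SZ[].
  by apply.
have Az : A z := NA _ Nz.
have nMz : ~ M z by case: Nz => -[].
have zx : z <> x by case: Nz.
(* Points of [L] outside [N] lie in [M] or equal [x], so [L] contributes only points of [N] to
   [A']. *)
pose L := [set p | A p /\ le p z].
pose L' := [set p | [/\ A p, le p z & p <> z]].
have autL : aut L.
  apply: dT; split=> [p []//|p q [Aq qz] Ap pq]; split=> //.
  exact: (tr p q z).
have autL' : aut L'.
  apply: dT; split=> [p []//|p q [Aq qz nqz] Ap pq]; split=> //.
    exact: (tr p q z).
  by move=> pz; apply: nqz; apply: an => //; rewrite -pz.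
pose A' := (x |` M) `|` L.
have A'A : A' `<=` A by move=> p [[->//|/MA[]//]|[]].
apply: (@induced_minor_P4_of_conflict P A' M (Z `|` G) x z) => //.
- exact: autU.
- rewrite (_ : A' `\ z = (x |` M) `|` L'); first exact: autU.
  apply/seteqP; split=> p /=.
    by case=> -[xMp|[Ap pz]] nz; [left|right].
  case=> [xMp|[Ap pz nz]]; split=> //; [by left| |by right].
  by move=> pz; rewrite pz in xMp; case: xMp.
- by move=> p Mp; split; [left; right|move=> pz; apply: nMz; rewrite -pz].
- by left; left.
- by right; split=> //; exact: rf.
- by move=> xz; case: zx.
- by move=> S autS SA' nSx; apply: Mmax => //; exact: subset_trans SA' A'A.
- move=> p [A'p nMp]; have [px|npx] := pselect (p = x).
    by left; split; [rewrite px|case=> _; apply].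
  by case: A'p => [[//|//]|[Ap pz]]; right; apply: Gz.
(* [Z] avoids [N] and hence [z], so removing [z] affects [G] alone. *)
- apply: contra_not nJG; rewrite /J /= (_ : Z `|` G `\ z = (Z `|` G) `\ z)//.
  apply/seteqP; split=> p /=.
    case=> [[Bp nNp]|[Gp pz]]; split=> //; [by left| |by right].
    by move=> pz; apply: nNp; rewrite pz.
  by case=> -[Zp|Gp] pz; [left|right].
Qed.
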